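(* For $n\ge 2$, let $u_n$ denote the number of maximal dominant weights of the $\widehat{sl}(n)$-module $V(3\Lambda_0)$, i.e. $u_n=|\max(3\Lambda_0)\cap P^+|$. Then for all $n\ge2$, $$u_n=\frac{1}{n+3}\sum_{d\mid\gcd(n,3)}\phi(d)\binom{\frac{n+3}{d}}{\frac{3}{d}},$$ where $\phi$ is the Euler phi function.
   Context: $\widehat{sl}(n)$ is the affine Kac-Moody algebra of type $A^{(1)}_{n-1}$, with fundamental weights $\Lambda_i$, null root $\delta$ and set $P^+$ of dominant integral weights (elements $\lambda$ of the weight lattice $P=\bigoplus_i\mathbb Z\Lambda_i\oplus\mathbb Z\delta$ with $\lambda(h_i)\ge0$ for all simple coroots $h_i$). $V(\Lambda)$ is the integrable highest weight module with highest weight $\Lambda$; $\max(\Lambda)$ is the set of maximal weights, i.e. weights $\mu$ of $V(\Lambda)$ such that $\mu+\delta$ is not a weight of $V(\Lambda)$. *)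

(* Defs.v *)
From HB Require Import structures.
From mathcomp Require Import all_boot all_order all_algebra.
From mathcomp Require Import boolp classical_sets cardinality reals.
From mathcomp Require Import complex.

Set Implicit Arguments.
Unset Strict Implicit.
Unset Printing Implicit Defensive.

Import Order.TTheory GRing.Theory Num.Theory.

Local Open Scope quotient_scope.
Local Open Scope ring_scope.

HB.mixin Record Lmodule_isLie (K : fieldType) (L : Type)
    of GRing.Lmodule K L := {
  lie : L -> L -> L;
  lie_linearl : forall y : L, linear (lie ^~ y);
  lie_linearr : forall x : L, linear (lie x);
  lie_alt : forall x : L, lie x x = 0;
  lie_jacobi : forall x y z : L,
    lie x (lie y z) + lie y (lie z x) + lie z (lie x y) = 0
}.

#[short(type="lieType")]
HB.structure Definition Lie (K : fieldType) :=
  {L of GRing.Lmodule K L & Lmodule_isLie K L}.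

Record lie_rep (K : fieldType) (g : lieType K) (V : lmodType K) := LieRep {
  act :> g -> V -> V;
  act_linearl : forall v : V, linear (act ^~ v);
  act_linearr : forall x : g, linear (act x);
  act_lie : forall (x y : g) (v : V),
    act (lie x y) v = act x (act y v) - act y (act x v)
}.

(* The Lie algebra presented by generators X and relations r = 0 (r in rels):
   Lie terms over X modulo the congruence generated by the axioms of Lie
   K-algebras and by the relations. *)
Section Presentation.
Variables (K : fieldType) (X : Type).

Inductive lterm : Type :=
| LGen of X
| LZero
| LOpp of lterm
| LAdd of lterm & lterm
| LScale of K & lterm
| LBr of lterm & lterm.

HB.instance Definition _ := gen_eqMixin lterm.
HB.instance Definition _ := gen_choiceMixin lterm.

Variable rels : lterm -> Prop.

Inductive lcong : lterm -> lterm -> Prop :=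
| lcong_refl s : lcong s s
| lcong_sym s t : lcong s t -> lcong t s
| lcong_trans s t u : lcong s t -> lcong t u -> lcong s u
| lcong_opp s t : lcong s t -> lcong (LOpp s) (LOpp t)
| lcong_add s s' t t' :
    lcong s s' -> lcong t t' -> lcong (LAdd s t) (LAdd s' t')
| lcong_scale a s t : lcong s t -> lcong (LScale a s) (LScale a t)
| lcong_br s s' t t' :
    lcong s s' -> lcong t t' -> lcong (LBr s t) (LBr s' t')
| lcong_addA s t u : lcong (LAdd s (LAdd t u)) (LAdd (LAdd s t) u)
| lcong_addC s t : lcong (LAdd s t) (LAdd t s)
| lcong_add0 s : lcong (LAdd LZero s) s
| lcong_addN s : lcong (LAdd (LOpp s) s) LZero
| lcong_scaleA a b s : lcong (LScale a (LScale b s)) (LScale (a * b) s)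
| lcong_scale1 s : lcong (LScale 1 s) s
| lcong_scaleDr a s t :
    lcong (LScale a (LAdd s t)) (LAdd (LScale a s) (LScale a t))
| lcong_scaleDl a b s :
    lcong (LScale (a + b) s) (LAdd (LScale a s) (LScale b s))
| lcong_brl a s t u :
    lcong (LBr (LAdd (LScale a s) t) u) (LAdd (LScale a (LBr s u)) (LBr t u))
| lcong_brr a s t u :
    lcong (LBr u (LAdd (LScale a s) t)) (LAdd (LScale a (LBr u s)) (LBr u t))
| lcong_alt s : lcong (LBr s s) LZero
| lcong_jacobi s t u :
    lcong (LAdd (LAdd (LBr s (LBr t u)) (LBr t (LBr u s))) (LBr u (LBr s t)))
      LZero
| lcong_rel r : rels r -> lcong r LZero.

Definition lcongb : rel lterm := fun s t => `[< lcong s t >].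

Lemma lcongb_refl : reflexive lcongb.
Proof. by move=> s; apply/asboolP; exact: lcong_refl. Qed.

Lemma lcongb_sym : symmetric lcongb.
Proof. by move=> s t; apply/asboolP/asboolP; exact: lcong_sym. Qed.

Lemma lcongb_trans : transitive lcongb.
Proof.
move=> t s u /asboolP st /asboolP tu; apply/asboolP; exact: lcong_trans st tu.
Qed.

Definition lcong_equiv : equiv_rel lterm :=
  EquivRel lcongb lcongb_refl lcongb_sym lcongb_trans.

Definition lpres : Type := {eq_quot lcong_equiv}.
HB.instance Definition _ := Choice.on lpres.

Definition lpi (s : lterm) : lpres := \pi_({eq_quot lcong_equiv}) s.
Definition lrepr (x : lpres) : lterm := repr (x : {eq_quot lcong_equiv}).

Lemma lpi_eq s t : lcong s t -> lpi s = lpi t.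
Proof. by move=> st; apply/eqmodP/asboolP. Qed.

Lemma lpi_cong s t : lpi s = lpi t -> lcong s t.
Proof. by move=> /eqmodP/asboolP. Qed.

Lemma lreprK x : lpi (lrepr x) = x.
Proof. exact: reprK. Qed.

Lemma lrepr_pi s : lcong (lrepr (lpi s)) s.
Proof. by apply: lpi_cong; rewrite lreprK. Qed.

Lemma lpres_ind (P : lpres -> Prop) : (forall s, P (lpi s)) -> forall x, P x.
Proof. by move=> Ps x; rewrite -(lreprK x). Qed.

Definition lzero : lpres := lpi LZero.
Definition lopp (x : lpres) : lpres := lpi (LOpp (lrepr x)).
Definition ladd (x y : lpres) : lpres := lpi (LAdd (lrepr x) (lrepr y)).
Definition lscale (a : K) (x : lpres) : lpres := lpi (LScale a (lrepr x)).
Definition lbr (x y : lpres) : lpres := lpi (LBr (lrepr x) (lrepr y)).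

Lemma lopp_pi s : lopp (lpi s) = lpi (LOpp s).
Proof. by apply: lpi_eq; apply: lcong_opp; exact: lrepr_pi. Qed.

Lemma ladd_pi s t : ladd (lpi s) (lpi t) = lpi (LAdd s t).
Proof. by apply: lpi_eq; apply: lcong_add; exact: lrepr_pi. Qed.

Lemma lscale_pi a s : lscale a (lpi s) = lpi (LScale a s).
Proof. by apply: lpi_eq; apply: lcong_scale; exact: lrepr_pi. Qed.

Lemma lbr_pi s t : lbr (lpi s) (lpi t) = lpi (LBr s t).
Proof. by apply: lpi_eq; apply: lcong_br; exact: lrepr_pi. Qed.

Lemma laddA : associative ladd.
Proof.
elim/lpres_ind=> s; elim/lpres_ind=> t; elim/lpres_ind=> u.
by rewrite !ladd_pi; apply: lpi_eq; exact: lcong_addA.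
Qed.

Lemma laddC : commutative ladd.
Proof.
elim/lpres_ind=> s; elim/lpres_ind=> t.
by rewrite !ladd_pi; apply: lpi_eq; exact: lcong_addC.
Qed.

Lemma ladd0 : left_id lzero ladd.
Proof.
by elim/lpres_ind=> s; rewrite ladd_pi; apply: lpi_eq; exact: lcong_add0.
Qed.

Lemma laddN : left_inverse lzero lopp ladd.
Proof.
elim/lpres_ind=> s.
by rewrite lopp_pi ladd_pi; apply: lpi_eq; exact: lcong_addN.
Qed.

HB.instance Definition _ := GRing.isZmodule.Build lpres laddA laddC ladd0 laddN.

Lemma lscaleA a b x : lscale a (lscale b x) = lscale (a * b) x.
Proof.
elim/lpres_ind: x => s.
by rewrite !lscale_pi; apply: lpi_eq; exact: lcong_scaleA.
Qed.

Lemma lscale1 : left_id 1 lscale.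
Proof.
by elim/lpres_ind=> s; rewrite lscale_pi; apply: lpi_eq; exact: lcong_scale1.
Qed.

Lemma lscaleDr : right_distributive lscale +%R.
Proof.
move=> a; elim/lpres_ind=> s; elim/lpres_ind=> t.
rewrite -[LHS]/(lscale a (ladd _ _)) -[RHS]/(ladd _ _).
by rewrite !(lscale_pi, ladd_pi); apply: lpi_eq; exact: lcong_scaleDr.
Qed.

Lemma lscaleDl x : {morph lscale^~ x : a b / a + b}.
Proof.
elim/lpres_ind: x => s a b; rewrite -[RHS]/(ladd _ _).
by rewrite !(lscale_pi, ladd_pi); apply: lpi_eq; exact: lcong_scaleDl.
Qed.

HB.instance Definition _ := GRing.Zmodule_isLmodule.Build K lpres
  lscaleA lscale1 lscaleDr lscaleDl.

Lemma lbr_linearl (y : lpres) : linear (lbr ^~ y).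
Proof.
elim/lpres_ind: y => u a; elim/lpres_ind=> s; elim/lpres_ind=> t.
rewrite -[LHS]/(lbr (ladd (lscale _ _) _) _) -[RHS]/(ladd (lscale _ _) _).
by rewrite !(lscale_pi, ladd_pi, lbr_pi); apply: lpi_eq; exact: lcong_brl.
Qed.

Lemma lbr_linearr (x : lpres) : linear (lbr x).
Proof.
elim/lpres_ind: x => u a; elim/lpres_ind=> s; elim/lpres_ind=> t.
rewrite -[LHS]/(lbr _ (ladd (lscale _ _) _)) -[RHS]/(ladd (lscale _ _) _).
by rewrite !(lscale_pi, ladd_pi, lbr_pi); apply: lpi_eq; exact: lcong_brr.
Qed.

Lemma lbr_alt (x : lpres) : lbr x x = 0.
Proof.
by elim/lpres_ind: x => s; rewrite lbr_pi; apply: lpi_eq; exact: lcong_alt.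
Qed.

Lemma lbr_jacobi (x y z : lpres) :
  lbr x (lbr y z) + lbr y (lbr z x) + lbr z (lbr x y) = 0.
Proof.
elim/lpres_ind: x => s; elim/lpres_ind: y => t; elim/lpres_ind: z => u.
rewrite -[LHS]/(ladd (ladd _ _) _) !(ladd_pi, lbr_pi).
by apply: lpi_eq; exact: lcong_jacobi.
Qed.

HB.instance Definition _ := Lmodule_isLie.Build K lpres
  lbr_linearl lbr_linearr lbr_alt lbr_jacobi.

End Presentation.

Arguments LZero {K X}.

(* Generalized Cartan matrix of type A^(1)_(n-1), for n >= 2.  For n = 2 both
   cyclic neighbours coincide, which gives the off-diagonal entries -2. *)
Definition cartan (n : nat) (i j : 'I_n) : int :=
  (i == j)%:Z *+ 2 - (j == ordS i)%:Z - (i == ordS j)%:Z.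

(* Chevalley generators e_i, f_i, the simple coroots h_i and the degree
   derivation d. *)
Inductive chevalley (n : nat) : Type :=
| GenE of 'I_n
| GenF of 'I_n
| GenH of 'I_n
| GenD.

Arguments GenD {n}.

Section AffineSl.
Variables (K : fieldType) (n : nat).

Let term := lterm K (chevalley n).
Let E (i : 'I_n) : term := LGen K (GenE i).
Let F (i : 'I_n) : term := LGen K (GenF i).
Let H (i : 'I_n) : term := LGen K (GenH i).
Let D : term := LGen K GenD.
Let sub (s t : term) : term := LAdd s (LOpp t).

(* The derivation d satisfies alpha_j(d) = 1 if j = 0, and 0 otherwise. *)
Inductive affine_rels : term -> Prop :=
| rel_hh i j : affine_rels (LBr (H i) (H j))
| rel_dh i : affine_rels (LBr D (H i))
| rel_he i j :
    affine_rels (sub (LBr (H i) (E j)) (LScale (cartan i j)%:~R (E j)))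
| rel_hf i j :
    affine_rels (sub (LBr (H i) (F j)) (LScale (- cartan i j)%:~R (F j)))
| rel_de j :
    affine_rels (sub (LBr D (E j)) (LScale (val j == 0%N)%:R (E j)))
| rel_df j :
    affine_rels (sub (LBr D (F j)) (LScale (- (val j == 0%N)%:R) (F j)))
| rel_ef i : affine_rels (sub (LBr (E i) (F i)) (H i))
| rel_ef0 i j : i != j -> affine_rels (LBr (E i) (F j))
| rel_serre_e i j : i != j ->
    affine_rels (iter `|1 - cartan i j|%N (LBr (E i)) (E j))
| rel_serre_f i j : i != j ->
    affine_rels (iter `|1 - cartan i j|%N (LBr (F i)) (F j)).

Definition affine_sl : Type := lpres affine_rels.
HB.instance Definition _ := Lie.on affine_sl.

Definition chev_gen (x : chevalley n) : affine_sl :=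
  lpi affine_rels (LGen K x).

End AffineSl.

(* The weight lattice P: the pair (a, b) stands for
   \sum_i a_i Lambda_i + b delta, i.e. for the weight taking the values a_i on
   h_i and b on d.  All weights of a highest weight module with highest weight
   in P lie in P. *)
Definition weight (n : nat) : Type := ({ffun 'I_n -> int} * int)%type.
HB.instance Definition _ n := GRing.Zmodule.on (weight n).

Definition wt_h n (mu : weight n) (i : 'I_n) : int := mu.1 i.
Definition wt_d n (mu : weight n) : int := mu.2.

Definition fund_weight n (i : 'I_n) : weight n :=
  ([ffun j => (j == i)%:Z], 0).

Definition null_root n : weight n := (0, 1).

Definition dominant n : set (weight n) :=
  [set mu | forall i, 0 <= wt_h mu i].

Section Modules.
Variables (K : fieldType) (n : nat) (V : lmodType K).
Variable rho : lie_rep (affine_sl K n) V.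

Let e (i : 'I_n) : V -> V := rho (chev_gen K (GenE i)).
Let f (i : 'I_n) : V -> V := rho (chev_gen K (GenF i)).
Let h (i : 'I_n) : V -> V := rho (chev_gen K (GenH i)).
Let d : V -> V := rho (chev_gen K GenD).

Definition weight_space (mu : weight n) : set V :=
  [set v | (forall i, h i v = (wt_h mu i)%:~R *: v) /\
           d v = (wt_d mu)%:~R *: v].

Definition is_weight (mu : weight n) : Prop :=
  exists2 v : V, weight_space mu v & v != 0.

Definition submodule (W : set V) : Prop :=
  [/\ W 0,
      forall (a : K) (v w : V), W v -> W w -> W (a *: v + w) &
      forall (x : affine_sl K n) (v : V), W v -> W (rho x v)].

Definition highest_weight_module (Lam : weight n) : Prop :=
  exists v : V,
    [/\ v != 0, weight_space Lam v, forall i, e i v = 0 &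
        forall W : set V, submodule W -> W v -> forall w, W w].

(* The diagonalizability of the Cartan subalgebra is automatic for highest
   weight modules, the only ones considered here. *)
Definition integrable : Prop :=
  (forall i v, exists m, iter m (e i) v = 0) /\
  (forall i v, exists m, iter m (f i) v = 0).

(* rho is (a model of) V(Lam), which is unique up to isomorphism. *)
Definition is_V (Lam : weight n) : Prop :=
  highest_weight_module Lam /\ integrable.

Definition max_weights : set (weight n) :=
  [set mu | is_weight mu /\ ~ is_weight (mu + null_root n)].

End Modules.

(* Main.v *)
(* A weight of a highest weight module is [Lam - \sum_j k_j alpha_j] with
   [k_j >= 0].  Conversely, a dominant weight of positive level of that form is
   a weight: one descends to it from [Lam] through weights, sl_2-theory
   providing each step.  Hence the dominant weights of V(l Lambda_0) lying over
   given values [a_i] on the [h_i] form a full half-line in the direction of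
   [- delta], nonempty iff [\sum_i a_i = l] and n divides [\sum_i i a_i], and
   the maximal ones correspond to such [a], i.e. to the multisets of size l of
   residues mod n with sum 0.  For l = 3 there are n^2 ordered triples of
   residues with sum 0, of which n have a given pair of coinciding entries and
   gcd(n, 3) are constant; so the number of multisets is
   [(n^2 + 3 n + 2 gcd(n, 3)) / 6]. *)
Require Import Defs.
From HB Require Import structures.
From mathcomp Require Import all_boot all_order all_algebra.
From mathcomp Require Import finmap.
From mathcomp Require Import boolp classical_sets cardinality reals.
From mathcomp Require Import complex.
From mathcomp Require Import zify ring.

Set Implicit Arguments.
Unset Strict Implicit.
Unset Printing Implicit Defensive.

Import Order.TTheory GRing.Theory Num.Theory.

Local Open Scope classical_set_scope.
Local Open Scope ring_scope.

(** * Root strings and the weights of highest weight modules *)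

Section Chevalley.
Variables (K : fieldType) (n : nat).
Let e (i : 'I_n) := chev_gen K (GenE i).
Let f (i : 'I_n) := chev_gen K (GenF i).
Let h (i : 'I_n) := chev_gen K (GenH i).
Let d := chev_gen K (@GenD n).

Lemma lpi_sub_eq (s t : lterm K (chevalley n)) :
  affine_rels (LAdd s (LOpp t)) ->
  lpi (@affine_rels K n) s = lpi (@affine_rels K n) t.
Proof.
move=> r; apply/eqP; rewrite -subr_eq0; apply/eqP.
rewrite -[LHS]/(ladd _ (lopp _)) lopp_pi ladd_pi.
exact/lpi_eq/lcong_rel.
Qed.

Lemma lie_ef i j : lie (e i) (f j) = if i == j then h i else 0.
Proof.
rewrite -[LHS]/(lbr _ _) lbr_pi; case: eqVneq => [<-|ij].
  exact/lpi_sub_eq/rel_ef.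
exact/lpi_eq/lcong_rel/rel_ef0.
Qed.

Lemma lie_he i j : lie (h i) (e j) = (cartan i j)%:~R *: e j.
Proof.
rewrite -[LHS]/(lbr _ _) -[RHS]/(lscale _ _) lbr_pi lscale_pi.
exact/lpi_sub_eq/rel_he.
Qed.

Lemma lie_hf i j : lie (h i) (f j) = (- cartan i j)%:~R *: f j.
Proof.
rewrite -[LHS]/(lbr _ _) -[RHS]/(lscale _ _) lbr_pi lscale_pi.
exact/lpi_sub_eq/rel_hf.
Qed.

Lemma lie_de j : lie d (e j) = (val j == 0%N)%:R *: e j.
Proof.
rewrite -[LHS]/(lbr _ _) -[RHS]/(lscale _ _) lbr_pi lscale_pi.
exact/lpi_sub_eq/rel_de.
Qed.

Lemma lie_df j : lie d (f j) = (- (val j == 0%N)%:R) *: f j.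
Proof.
rewrite -[LHS]/(lbr _ _) -[RHS]/(lscale _ _) lbr_pi lscale_pi.
exact/lpi_sub_eq/rel_df.
Qed.

End Chevalley.

Definition simple_root n (j : 'I_n) : weight n :=
  ([ffun i => cartan i j], (val j == 0%N)%:Z).

Lemma wt_hD n (mu nu : weight n) i : wt_h (mu + nu) i = wt_h mu i + wt_h nu i.
Proof. by rewrite /wt_h ffunE. Qed.

Lemma wt_hN n (mu : weight n) i : wt_h (- mu) i = - wt_h mu i.
Proof. by rewrite /wt_h ffunE. Qed.

Lemma wt_dD n (mu nu : weight n) : wt_d (mu + nu) = wt_d mu + wt_d nu.
Proof. by []. Qed.

Lemma wt_dN n (mu : weight n) : wt_d (- mu) = - wt_d mu.
Proof. by []. Qed.

Lemma wt_h_root n (i j : 'I_n) : wt_h (simple_root j) i = cartan i j.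
Proof. by rewrite /wt_h ffunE. Qed.

Lemma weight_ext n (mu nu : weight n) :
  wt_h mu =1 wt_h nu -> wt_d mu = wt_d nu -> mu = nu.
Proof.
by case: mu nu => a b [a' b'] /= Ha Hb; congr pair => //; apply/ffunP.
Qed.

(** Collects equal terms; it serves both for the weights of monomials in the [f_j] and for multisets
    of residues. *)
Lemma sum_count_mem (I : finType) (V : zmodType) (F : I -> V) (s : seq I) :
  \sum_(j <- s) F j = \sum_j F j *+ count_mem j s.
Proof.
elim: s => [|i s IH]; first by rewrite big_nil big1.
rewrite big_cons IH (bigD1 i) //= [RHS](bigD1 i) //= eqxx mulrS addrA.
by congr (_ + _); apply: eq_bigr => j; rewrite eq_sym => /negPf ->.
Qed.

Section Rep.
Variables (K : numFieldType) (n : nat) (V : lmodType K).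
Variable rho : lie_rep (affine_sl K n) V.
Let e (i : 'I_n) : V -> V := rho (chev_gen K (GenE i)).
Let f (i : 'I_n) : V -> V := rho (chev_gen K (GenF i)).
Let h (i : 'I_n) : V -> V := rho (chev_gen K (GenH i)).
Let d : V -> V := rho (chev_gen K GenD).

Lemma act_add x v w : rho x (v + w) = rho x v + rho x w.
Proof. by have := act_linearr rho x 1 v w; rewrite !scale1r. Qed.

Lemma act0 x : rho x 0 = 0.
Proof. by apply/(addrI (rho x 0)); rewrite -act_add !addr0. Qed.

Lemma act_scale x a v : rho x (a *: v) = a *: rho x v.
Proof. by have := act_linearr rho x a v 0; rewrite act0 !addr0. Qed.

Lemma actDl x y v : rho (x + y) v = rho x v + rho y v.
Proof. by have := act_linearl rho v 1 x y; rewrite !scale1r. Qed.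

Lemma act0l v : rho 0 v = 0.
Proof. by apply/(addrI (rho 0 v)); rewrite -actDl !addr0. Qed.

Lemma actZl a x v : rho (a *: x) v = a *: rho x v.
Proof. by have := act_linearl rho v a x 0; rewrite act0l !addr0. Qed.

Lemma act_comm x y v : rho x (rho y v) = rho y (rho x v) + rho (lie x y) v.
Proof. by rewrite act_lie addrC subrK. Qed.

Lemma weight_space_e mu j v :
  weight_space rho mu v -> weight_space rho (mu + simple_root j) (e j v).
Proof.
move=> [hv dv]; split => [i|].
  rewrite act_comm hv lie_he actZl act_scale -scalerDl wt_hD wt_h_root.
  by rewrite intrD.
by rewrite act_comm dv lie_de actZl act_scale -scalerDl wt_dD intrD -pmulrn.
Qed.

Lemma weight_space_f mu j v :
  weight_space rho mu v -> weight_space rho (mu - simple_root j) (f j v).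
Proof.
move=> [hv dv]; split => [i|].
  rewrite act_comm hv lie_hf actZl act_scale -scalerDl wt_hD wt_hN wt_h_root.
  by rewrite intrD.
rewrite act_comm dv lie_df actZl act_scale -scalerDl wt_dD wt_dN intrD.
by rewrite mulrNz -pmulrn.
Qed.

Lemma wt_h_rootMn (i j : 'I_n) k :
  wt_h (simple_root j *+ k) i = cartan i j * k%:Z.
Proof.
elim: k => [|k IH]; first by rewrite mulr0 /wt_h ffunE.
by rewrite mulrSr wt_hD IH wt_h_root -addn1 PoszD mulrDr mulr1.
Qed.

Lemma cartan_diag (i : 'I_n) : (1 < n)%N -> cartan i i = 2.
Proof.
move=> n1; rewrite /cartan eqxx.
have /negPf -> : i != ordS i; last by [].
rewrite -val_eqE /=; have := ltn_ord i; rewrite leq_eqVlt => /orP [/eqP iE|lt].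
  by rewrite iE modnn; lia.
by rewrite modn_small //; lia.
Qed.

Lemma h_f_iter i w (p : int) k : (1 < n)%N -> h i w = p%:~R *: w ->
  h i (iter k (f i) w) = (p - k%:Z *+ 2)%:~R *: iter k (f i) w.
Proof.
move=> n1 hw; elim: k => [|k IH]; first by rewrite subr0.
rewrite iterS {1}/h {1}/f act_comm -/(h i _) IH act_scale lie_hf actZl.
rewrite -scalerDl -intrD cartan_diag //; congr (_%:~R *: _).
by rewrite intS; ring.
Qed.

(** The [sl_2] identity: moving [e_i] past each [f_i] contributes an eigenvalue [p - 2 k] of [h_i],
    and these add up over [0 <= k <= m] to [(m + 1) (p - m)]. *)
Lemma e_f_iter i w (p : int) m : (1 < n)%N ->
  e i w = 0 -> h i w = p%:~R *: w ->
  e i (iter m.+1 (f i) w) = (m.+1%:Z * (p - m%:Z))%:~R *: iter m (f i) w.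
Proof.
move=> n1 ew hw; elim: m => [|m IH].
  rewrite /= /e /f act_comm -/(e i w) ew act0 add0r lie_ef eqxx -/(h i w) hw.
  by congr (_%:~R *: _); ring.
rewrite iterS {1}/e {1}/f act_comm -/(e i _) IH act_scale.
rewrite lie_ef eqxx -/(h i _) (h_f_iter _ n1 hw).
rewrite iterS -scalerDl -intrD; congr (_%:~R *: _).
by rewrite !intS; ring.
Qed.

(* The top vector [w] of the i-th root string through a vector of weight [mu]
   has [e_i f_i^k w] equal to a nonzero multiple of [f_i^(k-1) w] as long as
   [k] does not exceed the eigenvalue of [h_i] on [w]. *)
Lemma is_weight_subr_root mu i : (1 < n)%N ->
  (forall v, exists m, iter m (e i) v = 0) ->
  is_weight rho mu -> 0 < wt_h mu i -> is_weight rho (mu - simple_root i).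
Proof.
move=> n1 nil_e [v mu_v v0] mu_i.
have ws_e m : weight_space rho (mu + simple_root i *+ m) (iter m (e i) v).
  elim: m => [|m IH]; first by rewrite addr0.
  by rewrite mulrSr addrA; exact: weight_space_e.
have [m [w0 ew]] : exists m, iter m (e i) v != 0 /\ e i (iter m (e i) v) = 0.
  have [|[|m] ve minm] := ex_minnP (P := fun m => iter m (e i) v == 0).
  - by have [m vm] := nil_e v; exists m; apply/eqP.
  - by rewrite /= (negPf v0) in ve.
  exists m; split; last exact/eqP.
  by apply/negP => /minm; rewrite ltnn.
have wsw := ws_e m; set w := iter m (e i) v in w0 ew wsw.
have hw := wsw.1 i; rewrite wt_hD wt_h_rootMn cartan_diag // in hw.
have ws_f k : weight_space rho (mu + simple_root i *+ m - simple_root i *+ k)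
    (iter k (f i) w).
  elim: k => [|k IH]; first by rewrite subr0.
  by rewrite mulrSr opprD addrA; exact: weight_space_f.
(* The eigenvalue of [h_i] on [w] is [wt_h mu i + 2 m], so for [k <= m] the factor
   [(k + 1) (wt_h mu i + 2 m - k)] is positive. *)
have f0 k : (k <= m.+1)%N -> iter k (f i) w != 0.
  elim: k => [//|k IH] km; apply: contra (IH (ltnW km)) => /eqP fk0.
  have /esym/eqP := e_f_iter k n1 ew hw; rewrite fk0 /e act0 scaler_eq0.
  by rewrite intr_eq0 mulf_eq0 => /orP [|//]; lia.
exists (iter m.+1 (f i) w); last exact: f0.
have := ws_f m.+1; rewrite mulrSr opprD addrA addrK //.
Qed.

Lemma weight_neq_witness (mu nu : weight n) : mu != nu ->
  exists (x : affine_sl K n) (t : weight n -> int), t mu != t nu /\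
    forall xi v, weight_space rho xi v -> rho x v = (t xi)%:~R *: v.
Proof.
move=> mu_nu; have [dE|dN] := eqVneq (wt_d mu) (wt_d nu); last first.
  by exists (chev_gen K GenD), (@wt_d n); split => // xi v [].
have [i iN] : exists i, wt_h mu i != wt_h nu i.
  apply/not_existsP => hE; case/eqP: mu_nu; apply: weight_ext => // i.
  by apply/eqP/negP => iN; apply: (hE i); apply/negP.
by exists (chev_gen K (GenH i)), ((@wt_h n)^~ i); split => // xi v [].
Qed.

(** [P] is a product of factors [x - t nu], one for each [nu] in [L], where the Cartan element [x]
    tells [mu] and [nu] apart. It replaces the linear independence of weight spaces; characteristic
    zero keeps distinct integer eigenvalues distinct. *)
Lemma weight_separator (mu : weight n) (L : seq (weight n)) : mu \notin L ->
  exists (P : V -> V) (c : weight n -> K), [/\ linear P, c mu != 0,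
    forall xi v, weight_space rho xi v -> P v = c xi *: v &
    forall xi, xi \in L -> c xi = 0].
Proof.
elim: L => [_|nu L IH].
  exists id, (fun=> 1); split => //; first exact: oner_neq0.
  by move=> xi v _; rewrite scale1r.
rewrite in_cons negb_or => /andP [mu_nu /IH [P [c [linP cmu cP cL]]]].
have [x [t [tmu tP]]] := weight_neq_witness mu_nu.
exists (fun v => rho x (P v) - (t nu)%:~R *: P v).
exists (fun xi => c xi * ((t xi)%:~R - (t nu)%:~R)); split.
- move=> a v w; rewrite linP act_add act_scale !scalerDr !scalerN scalerA.
  by rewrite mulrC -scalerA opprD addrACA.
- by rewrite mulf_neq0 // subr_eq0 eqr_int.
- move=> xi v xi_v; rewrite (cP _ _ xi_v) act_scale (tP _ _ xi_v) !scalerA.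
  by rewrite -scalerBl; congr (_ *: _); rewrite mulrBr [_ * c xi]mulrC.
- move=> xi; rewrite in_cons => /orP [/eqP ->|/cL ->]; last exact: mul0r.
  by rewrite subrr mulr0.
Qed.

(** * Generation of a highest weight module by monomials in the [f_j] *)

Section HighestWeight.
Variables (Lam : weight n) (v : V).
Hypotheses (v_Lam : weight_space rho Lam v) (ev : forall i, e i v = 0).

Let fw (s : seq 'I_n) : V := foldr f v s.
Let span (w : V) : Prop :=
  exists l : seq (K * seq 'I_n), w = \sum_(p <- l) p.1 *: fw p.2.

Let span0 : span 0. Proof. by exists [::]; rewrite big_nil. Qed.

Let span_fw s : span (fw s).
Proof. by exists [:: (1, s)]; rewrite big_seq1 scale1r. Qed.

Let span_scale a w : span w -> span (a *: w).
Proof.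
move=> [l ->]; exists [seq (a * p.1, p.2) | p <- l]; rewrite big_map scaler_sumr.
by apply: eq_bigr => p _; rewrite scalerA.
Qed.

Let span_add w w' : span w -> span w' -> span (w + w').
Proof. by move=> [l ->] [l' ->]; exists (l ++ l'); rewrite big_cat. Qed.

Let span_act x : (forall s, span (rho x (fw s))) ->
  forall w, span w -> span (rho x w).
Proof.
move=> fwx _ [l ->]; elim: l => [|p l IH]; first by rewrite big_nil act0.
by rewrite big_cons act_add act_scale; apply/span_add => //; apply/span_scale.
Qed.

Let wt_fw s : weight_space rho (Lam - \sum_(j <- s) simple_root j) (fw s).
Proof.
elim: s => [|j s IH] /=; first by rewrite big_nil subr0.
by rewrite big_cons opprD addrCA addrC; exact: weight_space_f.
Qed.

(** Induction on the word: [e_i f_j = f_j e_i + [e_i, f_j]], and the bracket is [0] or [h_i], which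
    acts on a monomial by a scalar. *)
Let span_e i s : span (e i (fw s)).
Proof.
elim: s => [|j s IH] /=; first by rewrite ev.
rewrite /e /f act_comm lie_ef; apply: span_add; last first.
  case: eqP => _; last by rewrite act0l.
  by rewrite (wt_fw s).1; exact/span_scale/span_fw.
by apply: span_act IH => s'; exact: (span_fw (j :: s')).
Qed.

(** Induction on a Lie term representing [x] reduces stability to the Chevalley generators, since a
    bracket acts as a commutator. *)
Let span_lie x w : span w -> span (rho x w).
Proof.
elim/lpres_ind: x w.
elim=> [[i|i|i|]||t IH|t IHt u IHu|a t IH|t IHt u IHu] w.
- exact/span_act/span_e.
- by apply: span_act => s; exact: (span_fw (i :: s)).
- by apply: span_act => s; rewrite (wt_fw s).1; exact/span_scale/span_fw.
- by apply: span_act => s; rewrite (wt_fw s).2; exact/span_scale/span_fw.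
- by move=> _; have -> := act0l w.
- rewrite -lopp_pi -[lopp _]/(- (_ : affine_sl K n)) -scaleN1r actZl.
  by move=> /IH; exact: span_scale.
- rewrite -ladd_pi -[ladd _ _]/((_ : affine_sl K n) + _) actDl => sw.
  exact: span_add (IHt _ sw) (IHu _ sw).
- rewrite -lscale_pi -[lscale _ _]/(_ *: (_ : affine_sl K n)) actZl.
  by move=> /IH; exact: span_scale.
- rewrite -lbr_pi -[lbr _ _]/(lie (_ : affine_sl K n) _) act_lie => sw.
  apply: span_add; first exact/IHt/IHu.
  by rewrite -scaleN1r; exact/span_scale/IHu/IHt.
Qed.

(** The span of the monomials is a submodule containing [v], so a vector of weight [mu] is a
    combination of monomials. If [mu] were none of their weights, a separating operator would kill
    every monomial but not the vector. *)
Lemma hw_weight mu :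
  (forall W : set V, submodule rho W -> W v -> forall w, W w) ->
  is_weight rho mu ->
  exists k : 'I_n -> nat, mu = Lam - \sum_j simple_root j *+ k j.
Proof.
move=> gen [w mu_w w0].
have [l wE] : span w.
  apply: (gen span); last exact: (span_fw [::]).
  by split => // a u u' su su'; exact/span_add/su'/span_scale.
pose wt (p : K * seq 'I_n) := Lam - \sum_(j <- p.2) simple_root j.
have [/mapP [p _ ->]|muL] := boolP (mu \in map wt l).
  by exists (fun j => count_mem j p.2); rewrite /wt sum_count_mem.
have [P [c [linP cmu cP cL]]] := weight_separator muL.
have P0 : P 0 = 0.
  by apply/(addrI (P 0)); have := linP 1 0 0; rewrite !scale1r !addr0.
have /eqP : P w = 0.
  rewrite wE {wE muL}; elim: l cL => [|p l IH] cL; first by rewrite big_nil.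
  rewrite big_cons linP IH => [|xi xiL]; last by rewrite cL // in_cons xiL orbT.
  by rewrite (cP _ _ (wt_fw _)) cL ?mem_head // scale0r scaler0 addr0.
by rewrite (cP _ _ mu_w) scaler_eq0 (negPf cmu) (negPf w0).
Qed.

End HighestWeight.

End Rep.

(** * The affine Cartan matrix *)

Section CartanMatrix.
Variable n : nat.
Implicit Types (k : 'I_n -> int) (i j : 'I_n).

(** The affine Cartan matrix is minus the second difference on the cycle of residues modulo [n]. *)
Lemma cartan_mul k i :
  \sum_j cartan i j * k j = k i *+ 2 - k (ordS i) - k (ord_pred i).
Proof.
have delta (j : 'I_n) : \sum_j' (j' == j)%:Z * k j' = k j.
  rewrite (bigD1 j) //= eqxx mul1r big1 ?addr0 // => j' /negPf ->.
  exact: mul0r.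
rewrite -[in RHS](delta i) -(delta (ordS i)) -(delta (ord_pred i)).
rewrite -sumrMnl -!sumrB; apply: eq_bigr => j _.
rewrite /cartan (eq_sym i (ordS j)) (can2_eq (@ordSK n) (@ord_predK n)).
rewrite (eq_sym i).
by ring.
Qed.

(** Cyclic shifts preserve the sum. In terms of weights: roots have level zero. *)
Lemma sum_cartan_mul k : \sum_i \sum_j cartan i j * k j = 0.
Proof.
rewrite (eq_bigr _ (fun i _ => cartan_mul k i)) !sumrB sumrMnl.
have -> : \sum_i k (ordS i) = \sum_i k i.
  by rewrite [RHS](reindex_inj (@ordS_inj n)).
have -> : \sum_i k (ord_pred i) = \sum_i k i.
  by rewrite [RHS](reindex_inj (@ord_pred_inj n)).
by ring.
Qed.

Lemma val_iter_ordS m i : val (iter m (@ordS n) i) = ((i + m) %% n)%N.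
Proof.
elim: m => [|m IH] /=; first by rewrite addn0 modn_small.
by rewrite IH -addn1 modnDml addn1 addnS.
Qed.

Lemma ordS_ind (Q : 'I_n -> Prop) i :
  Q i -> (forall j, Q j -> Q (ordS j)) -> forall j, Q j.
Proof.
(* From [i], going up [n - i] steps closes the cycle at [0], and [j] more steps reach [j]. *)
move=> Qi QS j; have -> : j = iter (n - i + j) (@ordS n) i.
  apply: val_inj; rewrite val_iter_ordS addnA subnKC; last exact/ltnW.
  by rewrite modnDl modn_small.
by elim: (n - i + j)%N => //= m; exact: QS.
Qed.

Lemma dvdz_ordS i : (n %| (ordS i)%:Z - i%:Z - 1)%Z.
Proof.
by rewrite -addrA -opprD -eqz_mod_dvd addrC -intS !modz_nat modn_mod.
Qed.

(** Summation by parts moves the second difference onto the coordinate [i], whose cyclic second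
    difference is a multiple of [n]. Hence the residue of [\sum_i i a_i] is constant on cosets of
    the root lattice. *)
Lemma dvdz_sum_cartan_mul k :
  (n %| \sum_(i < n) i%:Z * \sum_j cartan i j * k j)%Z.
Proof.
have -> : \sum_(i < n) i%:Z * \sum_j cartan i j * k j =
    \sum_(j < n) (j%:Z *+ 2 - (ord_pred j)%:Z - (ordS j)%:Z) * k j.
  under eq_bigr => i _ do rewrite cartan_mul 2!mulrBr.
  under [RHS]eq_bigr => j _ do rewrite 2!mulrBl.
  rewrite !sumrB; congr (_ - _ - _).
  - by apply: eq_bigr => i _; ring.
  - rewrite [RHS](reindex_inj (@ordS_inj n)).
    by apply: eq_bigr => i _; rewrite ordSK.
  - rewrite [RHS](reindex_inj (@ord_pred_inj n)).
    by apply: eq_bigr => i _; rewrite ord_predK.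
apply: rpred_sum => j _; apply: dvdz_mulr.
have -> : j%:Z *+ 2 - (ord_pred j)%:Z - (ordS j)%:Z =
    (ordS (ord_pred j))%:Z - (ord_pred j)%:Z - 1 - ((ordS j)%:Z - j%:Z - 1).
  by rewrite ord_predK; ring.
by rewrite rpredB // dvdz_ordS.
Qed.

End CartanMatrix.

(** Converse of the two preceding invariants: a second difference equation on a cycle is solved by
    summing twice. The zero sum closes up the first sum [C], the divisibility closes up the second
    sum [k]. *)
Lemma cartan_solve n (c : 'I_n -> int) :
  \sum_i c i = 0 -> (n %| \sum_(i < n) i%:Z * c i)%Z ->
  exists k : 'I_n -> int, forall i, \sum_j cartan i j * k j = c i.
Proof.
move=> c0 /dvdzP [q cq].
case: n c c0 cq => [|n'] c c0 cq; first by exists (fun=> 0) => -[].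
pose c' m := c (inord m).
have c'E (i : 'I_n'.+1) : c i = c' i by rewrite /c' inord_val.
pose C m := \sum_(0 <= l < m) c' l.
have C0 : C n'.+1 = 0.
  by rewrite -c0 /C big_mkord; apply: eq_bigr => i _; rewrite c'E.
have CS m : C m.+1 = C m + c' m by rewrite /C big_nat_recr.
(* The slope [- q] is the free constant of the second summation; as [q n] is the weighted sum of
   [c], it gives [k n'.+1 = k 0 = 0]. *)
pose k m : int := \sum_(0 <= j < m) (- q - C j.+1).
have kS m : k m.+1 = k m - q - C m.+1 by rewrite /k big_nat_recr //= addrA.
have kn : k n'.+1 = 0.
  have kE m : k m = \sum_(0 <= j < m) j%:Z * c' j - m%:Z * (q + C m).
    elim: m => [|m IH]; first by rewrite /k !big_nil mul0r subrr.
    by rewrite kS IH big_nat_recr //= CS intS; ring.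
  rewrite kE C0 big_mkord; under eq_bigr => i _ do rewrite -c'E.
  by rewrite cq; ring.
exists (fun j : 'I_n'.+1 => k j) => i.
rewrite (cartan_mul (fun j : 'I_n'.+1 => k j)).
have kSi : k (ordS i) = k i.+1.
  rewrite /=; have := ltn_ord i; rewrite ltnS leq_eqVlt => /orP [/eqP ->|lt].
    by rewrite modnn kn /k big_nil.
  by rewrite modn_small.
have kPi : k (ord_pred i) = k i + q + C i.
  rewrite /= ; case: i {kSi} => [[|m] mn] /=.
    rewrite modn_small //; have := kS n'; rewrite kn C0 /k /C !big_nil /=.
    by move/esym/eqP; rewrite subr0 subr_eq0 => /eqP ->; ring.
  by rewrite modnDr modn_small ?kS; [ring | exact: ltnW].
by rewrite kSi kPi kS CS c'E; ring.
Qed.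

Lemma wt_h_sum_root n (k : 'I_n -> nat) i :
  wt_h (\sum_j simple_root j *+ k j) i = \sum_j cartan i j * k j.
Proof.
rewrite (big_morph (fun mu : weight n => wt_h mu i) (id1 := 0) (op1 := +%R)).
- by apply: eq_bigr => j _; rewrite wt_h_rootMn.
- by move=> mu nu; rewrite wt_hD.
- by rewrite /wt_h ffunE.
Qed.

Lemma wt_d_sum_root n (k : 'I_n -> nat) (i0 : 'I_n) : val i0 = 0%N ->
  wt_d (\sum_j simple_root j *+ k j) = k i0.
Proof.
move=> i00; rewrite (big_morph (@wt_d n) (id1 := 0) (op1 := +%R)) //.
have wt_dM j m : wt_d (simple_root j *+ m) = (j == i0)%:Z * m%:Z.
  elim: m => [|m IH]; first by rewrite mulr0.
  by rewrite mulrSr wt_dD IH intS mulrDr mulr1 addrC -val_eqE i00.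
rewrite (bigD1 i0) //= big1 ?addr0 => [|j /negPf ji].
  by rewrite wt_dM eqxx mul1r.
by rewrite wt_dM ji mul0r.
Qed.

(** * Maximal dominant weights *)

Section DominantWeights.
Variables (K : numFieldType) (n : nat) (V : lmodType K).
Variable rho : lie_rep (affine_sl K n) V.
Hypothesis n1 : (1 < n)%N.
Hypothesis nil_e :
  forall (i : 'I_n) v, exists m, iter m (rho (chev_gen K (GenE i))) v = 0.

(* If the claim fails then [mu - lam = \sum_j k_j alpha_j] is nonpositive on
   every [h_i]; as its level is zero it vanishes on every [h_i].  Then a zero
   of [k] would propagate along the cyclic Dynkin diagram, so all [k_i] are
   positive and [mu] has nonpositive level. *)
Lemma descent_step (mu lam : weight n) (k : 'I_n -> nat) :
  dominant lam -> 0 < \sum_i wt_h lam i ->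
  mu = lam + \sum_j simple_root j *+ k j ->
  (exists i, k i != 0%N) -> exists i, (0 < k i)%N && (0 < wt_h mu i).
Proof.
move=> dom lev muE [i1 ki1]; apply: contrapT => /forallNP noi.
pose D i := \sum_j cartan i j * (k j)%:Z.
have muD i : wt_h mu i = wt_h lam i + D i.
  by rewrite muE wt_hD wt_h_sum_root.
have D_le0 i : D i <= 0.
  have [ki|ki] := posnP (k i).
    rewrite /D (cartan_mul (fun j => (k j)%:Z)) ki.
    by lia.
  have := noi i; have := muD i; rewrite ki /=; have := dom i; lia.
have D0 i : D i = 0.
  have /eqP : \sum_i - D i = 0.
    by rewrite sumrN (sum_cartan_mul (fun j => (k j)%:Z)) oppr0.
  rewrite psumr_eq0 => [/allP /(_ i)|j _]; last by rewrite oppr_ge0.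
  by rewrite mem_index_enum oppr_eq0 => /(_ isT) /eqP.
have [[i0 ki0]|kN0] := pselect (exists i, k i = 0%N).
  case/eqP: ki1; move: i1; apply: (ordS_ind ki0) => j kj.
  have := D0 j; rewrite /D (cartan_mul (fun j => (k j)%:Z)) kj; lia.
suff : \sum_i wt_h lam i <= 0 by lia.
apply: sumr_le0 => i _; have := noi i; have := muD i; rewrite D0.
have : k i != 0%N by apply/eqP => ki; apply: kN0; exists i.
by lia.
Qed.

(** Induction on the height [\sum_i k i] of [mu - lam]: [descent_step] finds a simple root still to
    be removed on which the root string through [mu] continues downwards. *)
Lemma is_weight_dominant (mu lam : weight n) (k : 'I_n -> nat) :
  is_weight rho mu -> dominant lam -> 0 < \sum_i wt_h lam i ->
  mu = lam + \sum_j simple_root j *+ k j -> is_weight rho lam.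
Proof.
move=> mu_wt dom lev; move: {2}(\sum_i k i)%N (erefl (\sum_i k i)%N) => m.
elim: m => [|m IH] in mu mu_wt k * => km muE.
  rewrite muE big1 ?addr0 // in mu_wt => j _.
  by move/eqP: km; rewrite sum_nat_eq0 => /forallP /(_ j) /eqP ->.
have [|i /andP [ki mui]] := descent_step dom lev muE.
  apply: contrapT => /forallNP k0; move: km; rewrite big1 // => j _.
  by apply/eqP/negP => /negP; exact: k0.
have kE j : k j = ((k j - (j == i)) + (j == i))%N.
  by rewrite subnK //; case: eqP => [->|].
have rootE (W : nmodType) (F : 'I_n -> W) : \sum_j F j *+ (j == i) = F i.
  by rewrite (bigD1 i) //= eqxx big1 ?addr0 // => j /negPf ->.
apply: (IH (mu - simple_root i) _ (fun j => k j - (j == i))%N).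
- exact: is_weight_subr_root.
- apply/eqP; rewrite -eqSS -km; apply/eqP.
  rewrite [RHS](eq_bigr _ (fun j _ => kE j)) big_split /=.
  have -> : (\sum_j (j == i) = 1)%N; last by rewrite addn1.
  by rewrite (bigD1 i) //= eqxx big1 // => j /negPf ->.
- apply/eqP; rewrite subr_eq -addrA; apply/eqP; rewrite muE; congr (_ + _).
  rewrite [LHS](eq_bigr _ (fun j _ => congr1 _ (kE j))).
  under eq_bigr => j _ do rewrite mulrnDr.
  by rewrite big_split /= rootE.
Qed.

End DominantWeights.

(** The values on the [h_i] of a dominant weight of level [l] congruent to [l Lambda_0] modulo the
    root lattice and multiples of [delta]. *)
Definition balanced n (l : nat) (a : 'I_n -> int) : Prop :=
  [/\ forall i, 0 <= a i, \sum_i a i = l &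
      (n %| \sum_(i < n) i%:Z * a i)%Z].

Lemma wt_h_null_rootMn n p (i : 'I_n) : wt_h (null_root n *+ p) i = 0.
Proof.
elim: p => [|p IH]; first by rewrite /wt_h ffunE.
by rewrite mulrSr wt_hD IH /wt_h ffunE.
Qed.

Lemma wt_d_null_rootMn n p : wt_d (null_root n *+ p) = p.
Proof. by elim: p => // p IH; rewrite mulrSr wt_dD IH intS addrC. Qed.

(** * Maximal dominant weights of [V(l Lambda_0)] and balanced families *)

Section MultiplesOfLambda0.
Variables (K : numFieldType) (n l : nat) (V : lmodType K).
Variable rho : lie_rep (affine_sl K n) V.
Hypotheses (n1 : (1 < n)%N) (l0 : (0 < l)%N).
Let i0 : 'I_n := Ordinal (ltnW n1).
Let Lam : weight n := fund_weight i0 *+ l.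
Hypothesis hV : is_V rho Lam.

Lemma wt_fund i : wt_h Lam i = (i == i0)%:Z * l%:Z.
Proof.
rewrite /Lam; elim: l => [|m IH]; first by rewrite mulr0 /wt_h ffunE.
by rewrite mulrSr wt_hD IH /wt_h ffunE intS mulrDr mulr1 addrC.
Qed.

Lemma sum_wt_fund : \sum_i wt_h Lam i = l.
Proof.
rewrite (bigD1 i0) // big1 => [|i /negPf i_neq0]; last first.
  by rewrite wt_fund i_neq0 mul0r.
by rewrite /= addr0 wt_fund eqxx mul1r.
Qed.

Lemma dvdz_wt_fund : (n %| \sum_(i < n) i%:Z * wt_h Lam i)%Z.
Proof.
rewrite big1 ?dvdz0 // => i _; rewrite wt_fund.
by case: eqP => [->|_]; rewrite /= mul0r ?mulr0.
Qed.

Lemma wt_d_fund : wt_d Lam = 0.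
Proof. by rewrite /Lam; elim: l => // m; rewrite mulrSr wt_dD => ->. Qed.

Lemma is_V_weight mu : is_weight rho mu ->
  exists k : 'I_n -> nat, mu = Lam - \sum_j simple_root j *+ k j.
Proof.
by have [[v [_ v_Lam ev gen]] _] := hV; exact: (hw_weight v_Lam ev gen).
Qed.

Lemma is_V_dominant_weight mu (k : 'I_n -> nat) : dominant mu ->
  mu = Lam - \sum_j simple_root j *+ k j -> is_weight rho mu.
Proof.
move=> dom muE; have [[v [v0 v_Lam _ _]] [nil_e _]] := hV.
apply: (is_weight_dominant n1 nil_e (mu := Lam) (k := k)) => //.
- by exists v.
- rewrite muE; under eq_bigr => i _ do rewrite wt_hD wt_hN wt_h_sum_root.
  by rewrite sumrB (sum_cartan_mul (fun j => (k j)%:Z)) subr0 sum_wt_fund.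
- by rewrite muE subrK.
Qed.

(** Bounds the weights above in the direction of [delta], which yields the existence of maximal
    ones. *)
Lemma wt_d_le0 mu : is_weight rho mu -> wt_d mu <= 0.
Proof.
move=> /is_V_weight [k ->].
by rewrite wt_dD wt_dN wt_d_fund (@wt_d_sum_root _ k i0) ?add0r ?oppr_le0.
Qed.

Lemma weight_balanced mu : is_weight rho mu -> dominant mu ->
  balanced l (wt_h mu).
Proof.
move=> /is_V_weight [k muE] dom.
have muh i : wt_h mu i = wt_h Lam i - \sum_j cartan i j * (k j)%:Z.
  by rewrite muE wt_hD wt_hN wt_h_sum_root.
split => //.
  rewrite (eq_bigr _ (fun i _ => muh i)) sumrB.
  by rewrite (sum_cartan_mul (fun j => (k j)%:Z)) subr0 sum_wt_fund.
under eq_bigr => i _ do rewrite muh mulrBr.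
by rewrite sumrB rpredB ?(dvdz_sum_cartan_mul (fun j => (k j)%:Z)) ?dvdz_wt_fund.
Qed.

(** [delta] is the sum of all simple roots: constants have zero second difference, and only
    [alpha_0] is nonzero on [d]. *)
Lemma sum_root_shift (k : 'I_n -> nat) p :
  \sum_j simple_root j *+ (k j + p) =
  \sum_j simple_root j *+ k j + null_root n *+ p.
Proof.
apply: weight_ext => [i|]; last first.
  by rewrite wt_dD !(@wt_d_sum_root _ _ i0) // wt_d_null_rootMn.
rewrite wt_hD !wt_h_sum_root wt_h_null_rootMn addr0.
rewrite (cartan_mul (fun j => (k j + p)%N%:Z)) (cartan_mul (fun j => (k j)%:Z)).
by lia.
Qed.

(** If [nu] lay above [mu], then [mu + delta = nu - p delta] with [p >= 0] would be a dominant
    weight of the form [Lam] minus simple roots, hence a weight of the module. *)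
Lemma max_weight_d_ge mu nu : max_weights rho mu -> dominant mu ->
  is_weight rho nu -> wt_h nu =1 wt_h mu -> wt_d nu <= wt_d mu.
Proof.
move=> [_ mu_max] dom /is_V_weight [k nuE] hE.
rewrite leNgt; apply/negP => lt_d; apply: mu_max.
have deltah i : wt_h (mu + null_root n) i = wt_h mu i.
  by rewrite wt_hD {2}/wt_h ffunE addr0.
pose p := absz (wt_d nu - wt_d mu - 1)%R.
apply: (is_V_dominant_weight (k := fun j => (k j + p)%N)).
  by move=> i; rewrite deltah.
rewrite sum_root_shift opprD addrA -nuE; apply: weight_ext => [i|].
  rewrite deltah -hE wt_hD wt_hN.
  by rewrite wt_h_null_rootMn subr0.
by rewrite !wt_dD wt_dN wt_d_null_rootMn {2}/wt_d /=; lia.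
Qed.

Lemma max_dominant_inj mu nu :
  (max_weights rho `&` @dominant n) mu -> (max_weights rho `&` @dominant n) nu ->
  wt_h mu =1 wt_h nu -> mu = nu.
Proof.
move=> [mu_max mu_dom] [nu_max nu_dom] hE; apply: weight_ext => //.
apply: le_anti; apply/andP; split; apply: max_weight_d_ge => //.
- exact: mu_max.1.
- exact: nu_max.1.
Qed.

Lemma balanced_max_weight (a : 'I_n -> int) : balanced l a ->
  exists2 mu, (max_weights rho `&` @dominant n) mu & wt_h mu =1 a.
Proof.
move=> [a_ge0 a_sum a_res].
have [k' k'E] : exists k' : 'I_n -> int,
    forall i, \sum_j cartan i j * k' j = wt_h Lam i - a i.
  apply: cartan_solve.
    by rewrite sumrB a_sum sum_wt_fund subrr.
  under eq_bigr => i _ do rewrite mulrBr.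
  by rewrite sumrB rpredB // dvdz_wt_fund.
(* Subtracting [p delta] makes all coefficients nonnegative without changing the values on the
   [h_i]. *)
pose p : nat := (\sum_j `|k' j|)%N.
pose k j := absz (k' j + p%:Z)%R.
have kE j : (k j)%:Z = k' j + p%:Z.
  have : (`|k' j| <= p)%N by rewrite /p (bigD1 j) //= leq_addr.
  by rewrite /k; lia.
(* The least such [m] belongs to the highest weight over [a], as weights are nonpositive on [d]. *)
pose has_d (m : nat) := `[< exists mu, [/\ is_weight rho mu, wt_h mu =1 a &
  wt_d mu = - m%:Z] >].
have [|m /asboolP [mu [mu_wt mu_h mu_d]] m_min] := ex_minnP (P := has_d).
  pose mu := Lam - \sum_j simple_root j *+ k j.
  have mu_h : wt_h mu =1 a.
    move=> i; rewrite wt_hD wt_hN wt_h_sum_root.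
    have := k'E i; rewrite (cartan_mul (fun j => (k j)%:Z)) cartan_mul !kE.
    by lia.
  have mu_wt : is_weight rho mu.
    by apply: (is_V_dominant_weight (k := k)) => // i; rewrite mu_h.
  exists `|wt_d mu|%N; apply/asboolP; exists mu; split => //.
  by have := wt_d_le0 mu_wt; lia.
exists mu => //; split; last by move=> i; rewrite mu_h.
split => // mu_wt'; have := wt_d_le0 mu_wt'.
have dE : wt_d (mu + null_root n) = 1 - m%:Z by rewrite wt_dD mu_d addrC.
(* Here [m >= 1], so a weight [mu + delta] would contradict the minimality of [m]. *)
rewrite dE => m0; have : (m <= m.-1)%N; last by lia.
apply: m_min; apply/asboolP; exists (mu + null_root n); split => //.
  by move=> i; rewrite wt_hD mu_h {1}/wt_h ffunE addr0.
by rewrite dE; lia.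
Qed.

End MultiplesOfLambda0.

(** * Counting multisets of residues *)

Lemma sum_ord_dvdn n m : (0 < n)%N -> (\sum_(z < n) (n %| m + z) = 1)%N.
Proof.
(* The unique solution is [- m] modulo [n]; the outer reduction covers the case where [n] divides
   [m]. *)
move=> n0; have zn : ((n - m %% n) %% n < n)%N by rewrite ltn_pmod.
rewrite (bigD1 (Ordinal zn)) //= big1 => [|z zN].
  rewrite addn0; apply/eqP; rewrite eqb1 /dvdn modnDmr -modnDml.
  by rewrite subnKC ?modnn // ltnW // ltn_pmod.
apply/eqP; rewrite eqb0; apply: contra zN => nz.
rewrite -val_eqE /= -(modn_small (ltn_ord z)) -(eqn_modDl m).
by rewrite -(modnDml m (n - _)) subnKC ?modnn // ltnW // ltn_pmod.
Qed.

(** If 3 does not divide [n], then 3 can be cancelled. If [n = 3 m], the condition becomes [m %| x],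
    solved once in each of three blocks of length [m]. *)
Lemma sum_ord_dvdn3 n : (0 < n)%N ->
  (\sum_(x < n) (n %| x + x + x) = if 3 %| n then 3 else 1)%N.
Proof.
move=> n0; case: ifP => [/dvdnP [m nE]|n3]; last first.
  rewrite -[RHS](sum_ord_dvdn 0 n0); apply: eq_bigr => x _.
  have -> : (x + x + x = 3 * x)%N by lia.
  by rewrite Gauss_dvdr // coprime_sym prime_coprime // n3.
have m0 : (0 < m)%N by lia.
have nEm : n = (m + (m + m))%N by lia.
have mE x : (n %| x + x + x)%N = (m %| x)%N.
  have -> : (x + x + x = x * 3)%N by lia.
  by rewrite nE dvdn_pmul2r.
under eq_bigr => x _ do rewrite mE.
rewrite nEm !big_split_ord /=.
rewrite (sum_ord_dvdn 0 m0) (sum_ord_dvdn m m0).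
under eq_bigr => x _ do rewrite addnA.
by rewrite sum_ord_dvdn.
Qed.

Section SortedTriples.
Variable n : nat.
Hypothesis n0 : (0 < n)%N.

Let S (F : 'I_n -> 'I_n -> 'I_n -> nat) : nat :=
  (\sum_x \sum_y \sum_z F x y z)%N.

Let eq_S F G : (forall x y z, F x y z = G x y z) -> S F = S G.
Proof. by move=> FG; do 3!(apply: eq_bigr => ? _); exact: FG. Qed.

Let S_add F G : S (fun x y z => F x y z + G x y z)%N = (S F + S G)%N.
Proof.
rewrite /S -big_split; apply: eq_bigr => x _ /=.
by rewrite -big_split; apply: eq_bigr => y _ /=; rewrite big_split.
Qed.

Let S12 F : S (fun x y z => F y x z) = S F.
Proof. by rewrite /S exchange_big. Qed.

Let S23 F : S (fun x y z => F x z y) = S F.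
Proof. by rewrite /S; apply: eq_bigr => x _; rewrite exchange_big. Qed.

Let S231 F : S (fun x y z => F y z x) = S F.
Proof. by rewrite -(S23 F) -(S12 (fun x y z => F x z y)). Qed.

Let S312 F : S (fun x y z => F z x y) = S F.
Proof. by rewrite -(S12 F) -(S23 (fun x y z => F y x z)). Qed.

Let S321 F : S (fun x y z => F z y x) = S F.
Proof. by rewrite -(S312 F) -(S12 (fun x y z => F z x y)). Qed.

Let c (x y z : 'I_n) : nat := (n %| x + y + z)%N.

Let c12 x y z : c y x z = c x y z. Proof. by rewrite /c (addnC y). Qed.
Let c23 x y z : c x z y = c x y z. Proof. by rewrite /c addnAC. Qed.

Let S_c : S (fun x y z => c x y z * 1)%N = (n * n)%N.
Proof.
rewrite (@eq_S _ c) => [|x y z]; last exact: muln1.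
rewrite /S /c; under eq_bigr => x _ do
  under eq_bigr => y _ do rewrite sum_ord_dvdn //.
by rewrite !sum_nat_const !card_ord muln1.
Qed.

Let S_eq12 : S (fun x y z => c x y z * (x == y))%N = n.
Proof.
transitivity (\sum_(x < n) 1)%N; last by rewrite sum_nat_const card_ord muln1.
apply: eq_bigr => x _; rewrite (bigD1 x) //= [X in (_ + X)%N]big1.
  rewrite addn0 -(sum_ord_dvdn (x + x) n0).
  by apply: eq_bigr => z _; rewrite eqxx muln1.
move=> y; rewrite eq_sym => /negPf ->; apply: big1 => z _.
by rewrite muln0.
Qed.

Let S_eq123 : S (fun x y z => c x y z * ((x == y) && (y == z)))%N =
  (if 3 %| n then 3 else 1)%N.
Proof.
rewrite -(sum_ord_dvdn3 n0).
apply: eq_bigr => x _; rewrite (bigD1 x) //= [X in (_ + X)%N]big1; last first.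
  move=> y; rewrite eq_sym => /negPf ->; apply: big1 => z _.
  by rewrite muln0.
rewrite addn0 (bigD1 x) //= big1 ?addn0 ?eqxx ?muln1 // => z.
by rewrite eq_sym => /negPf ->; rewrite muln0.
Qed.

(** Multisets of three residues with sum zero, each represented by its nondecreasing listing. *)
Definition sorted_triples : {set 'I_n * 'I_n * 'I_n} :=
  [set p : 'I_n * 'I_n * 'I_n |
    (p.1.1 <= p.1.2 <= p.2)%N && (n %| p.1.1 + p.1.2 + p.2)%N].

Let card_S : #|sorted_triples| = S (fun x y z => c x y z * (x <= y <= z))%N.
Proof.
rewrite -sum1_card big_mkcond /= /S pair_bigA pair_bigA /=.
apply: eq_bigr => -[[x y] z] _ /=; rewrite inE /c /=.
by case: (_ <= _ <= _)%N; case: (_ %| _)%N.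
Qed.

(* The six orderings of [x], [y], [z] are sorted in number
   1 + [x = y] + [y = z] + [x = z] + 2 [x = y = z]; sum this over all ordered
   triples counted by [c]. *)
Lemma card_sorted_triples :
  (6 * #|sorted_triples| = n * n + 3 * n + 2 * (if 3 %| n then 3 else 1))%N.
Proof.
pose G x y z : nat := (c x y z * (x <= y <= z)%N)%N.
have GS : S G = #|sorted_triples| by rewrite card_S.
pose E x y z : nat := (c x y z * (x == y))%N.
have ES : S E = n by exact: S_eq12.
pose T x y z : nat := (c x y z * ((x == y) && (y == z)))%N.
have TS : S T = (if 3 %| n then 3 else 1)%N by exact: S_eq123.
have key x y z : (G x y z + G x z y + (G y x z + G y z x) +
    (G z x y + G z y x) = c x y z * 1 + E x y z + (E x z y + E z y x) +
    (T x y z + T x y z))%N.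
  have e1 : c x z y = c x y z by [].
  have e2 : c y x z = c x y z by [].
  have e3 : c y z x = c x y z by rewrite c23 c12.
  have e4 : c z x y = c x y z by rewrite c12 c23.
  have e5 : c z y x = c x y z by rewrite c12 e3.
  rewrite /G /E /T e1 e2 e3 e4 e5 -!mulnDr; congr (_ * _)%N.
  rewrite -!val_eqE /=.
  case: (ltngtP x y); case: (ltngtP y z); case: (ltngtP x z) => //=; lia.
have := eq_S key; rewrite !S_add S_c TS (S23 G) (S12 G) (S231 G) (S312 G) (S321 G).
rewrite (S23 E) (S321 E) ES.
by rewrite -GS; lia.
Qed.

End SortedTriples.

(** As [gcdn n 3] is 1 or 3, the divisor sum has one or two terms, and clearing denominators leaves
    a polynomial identity. *)
Lemma card_formula n m :
  (6 * m = n * n + 3 * n + 2 * (if 3 %| n then 3 else 1))%N ->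
  (m%:R : rat) = (n + 3)%:R^-1 *
      \sum_(d <- divisors (gcdn n 3))
        (totient d * 'C((n + 3) %/ d, 3 %/ d))%:R.
Proof.
move=> m6.
have bin3 : (6 * 'C(n + 3, 3) = (n + 3) * (n + 2) * (n + 1))%N.
  rewrite mulnC (_ : 6 = 3`!)%N // bin_ffact !ffactnS ffactn0 muln1 mulnA.
  by rewrite addn3 /= addn2 addn1.
have n3 : (n + 3)%:R != 0 :> rat by rewrite pnatr_eq0 addn3.
apply: (mulfI n3); rewrite mulrA divff // mul1r -natrM.
case: ifP m6 => [d3|/negbT d3] m6.
  have -> : divisors (gcdn n 3) = [:: 1; 3]%N by rewrite (gcdn_idPr d3).
  rewrite big_cons big_seq1 -natrD; congr (_%:R).
  rewrite divn1 (_ : 3 %/ 1 = 3)%N // (_ : 3 %/ 3 = 1)%N // bin1.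
  rewrite (_ : totient 1 = 1)%N // (_ : totient 3 = 2)%N // mul1n.
  have /dvdnP [q qE] := d3.
  have -> : ((n + 3) %/ 3 = q.+1)%N by rewrite qE -mulSnr mulnK.
  nia.
have -> : divisors (gcdn n 3) = [:: 1]%N.
  suff -> : gcdn n 3 = 1%N by [].
  by apply/eqP; rewrite -/(coprime _ _) coprime_sym prime_coprime.
rewrite big_seq1; congr (_%:R).
rewrite !divn1 (_ : totient 1 = 1)%N // mul1n.
nia.
Qed.

(** * Balanced families as multiplicities of sorted sequences of residues *)

Section MultisetsAsSequences.
Variable n : nat.
Implicit Types s t : seq 'I_n.

Lemma sum_mem_size s : \sum_i (count_mem i s)%:Z = size s.
Proof.
transitivity (\sum_(i <- s) (1 : int)).
  by rewrite [RHS]sum_count_mem; apply: eq_bigr => i _; rewrite natz.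
by rewrite big_const_seq count_predT iter_addr_0 natz.
Qed.

Lemma sum_mem_val s :
  \sum_(i < n) i%:Z * (count_mem i s)%:Z = (\sum_(i <- s) i)%N.
Proof.
rewrite (big_morph Posz PoszD erefl) [RHS]sum_count_mem; apply: eq_bigr => i _.
by rewrite -mulr_natr natz.
Qed.

Lemma count_mem_balanced s :
  (n %| \sum_(i <- s) i)%N -> balanced (size s) (fun i => (count_mem i s)%:Z).
Proof.
by move=> ns; split => //; [exact: sum_mem_size | rewrite sum_mem_val].
Qed.

Lemma balanced_count_mem l (a : 'I_n -> int) : balanced l a ->
  exists s, [/\ size s = l, sorted (relpre val leq) s,
    (n %| \sum_(i <- s) i)%N & forall i, a i = (count_mem i s)%:Z].
Proof.
move=> [a0 a_sum a_res].
pose s := sort (relpre val leq)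
  (flatten [seq nseq `|a i|%N i | i <- index_enum 'I_n]).
have sE i : a i = (count_mem i s)%:Z.
  rewrite (permP (permEl (perm_sort _ _))) count_flatten sumnE !big_map.
  rewrite (bigD1 i) //= big1 => [|j /negPf ji].
    by rewrite count_nseq /= eqxx; have := a0 i; lia.
  by rewrite count_nseq /= ji.
exists s; split => //.
- apply/eqP; rewrite -eqz_nat -sum_mem_size -a_sum.
  by apply/eqP/eq_bigr => i _; rewrite sE.
- by apply: sort_sorted => i j; exact: leq_total.
- suff : (n %| (\sum_(i <- s) i)%N%:Z)%Z by [].
  by rewrite -sum_mem_val; under eq_bigr => i _ do rewrite -sE.
Qed.

Lemma sorted_count_mem_inj s t :
  sorted (relpre val leq) s -> sorted (relpre val leq) t ->
  (forall i, count_mem i s = count_mem i t) -> s = t.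
Proof.
move=> ss st E; apply: (sorted_eq _ _ ss st).
- by move=> i j k; exact: leq_trans.
- by move=> i j /= /anti_leq; exact: val_inj.
- by apply/allP => i _ /=; rewrite E.
Qed.

End MultisetsAsSequences.

(** A sorted triple is sent to a maximal dominant weight whose values on the [h_i] are its
    multiplicities. These determine the triple, and they determine the weight by [max_dominant_inj];
    every maximal dominant weight is reached because it is balanced. *)
Lemma card_max_dominant_weights (K : numFieldType) (n : nat)
    (V : lmodType K) (rho : lie_rep (affine_sl K n) V) (n1 : (1 < n)%N) :
  is_V rho (fund_weight (Ordinal (ltnW n1)) *+ 3) ->
  finite_set (max_weights rho `&` @dominant n) /\
  #|` fset_set (max_weights rho `&` @dominant n)| = #|sorted_triples n|.
Proof.
move=> hV; set M := max_weights rho `&` @dominant n.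
pose s (p : 'I_n * 'I_n * 'I_n) := [:: p.1.1; p.1.2; p.2].
have sX p : p \in sorted_triples n ->
    sorted (relpre val leq) (s p) /\ (n %| \sum_(i <- s p) i)%N.
  by rewrite inE /= andbT !big_cons big_nil addn0 addnA => /andP [].
have [F FP] : {F : 'I_n * 'I_n * 'I_n -> weight n &
    forall p, p \in sorted_triples n ->
      M (F p) /\ wt_h (F p) =1 fun i => (count_mem i (s p))%:Z}.
  apply: (@choice _ _ (fun p mu => p \in sorted_triples n ->
    M mu /\ wt_h mu =1 fun i => (count_mem i (s p))%:Z)) => p.
  (* Outside the sorted triples the value [0] is a mere default. *)
  have [/sX [_ /count_mem_balanced bal]|_] := boolP (p \in _); last by exists 0.
  by have [mu] := balanced_max_weight (l := 3) isT hV bal; exists mu.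
pose L := [seq F p | p <- enum (sorted_triples n)].
have L_uniq : uniq L.
  rewrite map_inj_in_uniq ?enum_uniq // => p q; rewrite !mem_enum => pX qX FE.
  have : s p = s q.
    apply: sorted_count_mem_inj; [exact: (sX p pX).1|exact: (sX q qX).1|].
    move=> i; apply/eqP; rewrite -eqz_nat -(FP p pX).2 -(FP q qX).2.
    by rewrite FE.
  by case: p q {pX qX FE} => [[x y] z] [[x' y'] z'] [-> -> ->].
have ME : M = [set` [fset mu in L]%fset].
  apply/seteqP; split => mu /=; rewrite inE /=; last first.
    by move=> /mapP [p]; rewrite mem_enum => /FP [Mp _] ->.
  move=> Mmu; have [[mu_wt _] mu_dom] := Mmu.
  have [t [t3 t_sorted nt tE]] :=
    balanced_count_mem (weight_balanced hV mu_wt mu_dom).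
  case: t t3 => [//|x [//|y [//|z [|//]]]] _ in t_sorted nt tE *.
  have xyzX : (x, y, z) \in sorted_triples n.
    move: t_sorted nt; rewrite inE /= andbT !big_cons big_nil addn0 addnA.
    by move=> -> ->.
  apply/mapP; exists (x, y, z); first by rewrite mem_enum.
  have [MF FE] := FP _ xyzX.
  by apply: (max_dominant_inj (l := 3) isT hV) => // i; rewrite FE tE.
rewrite ME; split; first exact: finite_fset.
by rewrite set_fsetK card_fseq undup_id // size_map -cardE.
Qed.

Theorem lemma3p10 (R : realType) (n : nat) (hn : (2 <= n)%N)
    (V : lmodType R[i]) (rho : lie_rep (affine_sl R[i] n) V)
    (hV : is_V rho (fund_weight (Ordinal (ltnW hn)) *+ 3)) :
  finite_set (max_weights rho `&` @dominant n) /\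
  (#|` fset_set (max_weights rho `&` @dominant n)|%:R : rat) =
    (n + 3)%:R^-1 *
      \sum_(d <- divisors (gcdn n 3))
        (totient d * 'C((n + 3) %/ d, 3 %/ d))%:R.
Proof.
have [fin ->] := card_max_dominant_weights hV; split => //.
by apply/card_formula/card_sorted_triples; exact: ltnW.
Qed.
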